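(* Any finite ordered family $I_1,\dots,I_n$ of intervals on the real line can be quasi-online $2$-properly $3$-colored; that is, there is a coloring of $I_1,\dots,I_n$ with $3$ colors such that for every $t\in\{1,\dots,n\}$ and every point $p\in\mathbb{R}$ contained in at least $2$ of the intervals $I_1,\dots,I_t$, the intervals among $I_1,\dots,I_t$ containing $p$ are not all of the same color.
   Context: An interval is a set $\{x\in\mathbb{R} : x_0<x<x_1\}$ for fixed $x_0,x_1$. Quasi-online means that the whole ordered family is known before coloring, but the coloring has to be proper for every initial segment $I_1,\dots,I_t$ of the family. *)

(* Defs.v *)
From mathcomp Require Export all_boot all_order all_algebra.
From mathcomp Require Export boolp classical_sets set_interval reals.

Set Implicit Arguments.
Unset Strict Implicit.
Unset Printing Implicit Defensive.
Import Order.TTheory GRing.Theory Num.Theory.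
Local Open Scope ring_scope.

(* Bounded and open; the endpoints are not required to satisfy x0 < x1, so the
   empty set is allowed.  Not to be confused with the library's [is_interval],
   which is order-convexity. *)
Definition open_interval (R : realType) (A : set R) : Prop :=
  exists x0 x1 : R, A = [set x : R | x0 < x < x1]%classic.

(* Indices, rather than sets, are collected, so that repeated members of the
   family count with multiplicity.  Indices start at 0: the initial segment
   I_1, ..., I_t consists of the i : 'I_n with i < t. *)
Definition covering (T : Type) (n : nat) (I : 'I_n -> set T) (t : nat) (p : T)
  : {set 'I_n} :=
  [set i : 'I_n | (i < t)%N && (p \in I i)]%SET.

Definition monochromatic (n k : nat) (c : 'I_n -> 'I_k) (S : {set 'I_n}) : Prop :=
  exists col : 'I_k, forall i : 'I_n, i \in S -> c i = col.

Definition quasi_online_proper (T : Type) (m k n : nat)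
    (I : 'I_n -> set T) (c : 'I_n -> 'I_k) : Prop :=
  forall t : nat, (1 <= t <= n)%N ->
  forall p : T, (m <= #|covering I t p|)%N -> ~ monochromatic c (covering I t p).

(* Main.v *)
Require Import Defs.
From mathcomp Require Import all_boot all_order all_algebra.
From mathcomp Require Import fingroup perm.
From mathcomp Require Import boolp classical_sets set_interval reals.

(** Call an index [o] the sole owner of a point [q] at time [k] when [o] is the
    only one of the first [k] intervals that contains [q].  Every other interval
    of that prefix misses [q], hence by convexity lies entirely to the left or
    entirely to the right of [q], and intervals on different sides are disjoint.
    So the only interaction between the two sides goes through [o]: permuting
    the colors of all the intervals to the left of [q] by a permutation that
    fixes the color of [o] keeps the coloring proper
    ([prefix_proper_recolor_left]).

    Take one point for each sole owner and treat these points from right to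
    left.  If the owner of the new point has the color to be avoided, swap that
    color, left of the point treated just before, with the one that is neither
    it nor the color of the owner there; this is where three colors are needed.
    All sole owners are thus freed from one prescribed color
    ([avoid_color_on_sole_owners]).  The next interval of the family can then
    receive that color: it creates a second cover only at points that had a sole
    owner, and the owner has another color there.  Induction on the length of
    the prefix concludes.  The colors of the earlier intervals are revised at
    every step, so the argument yields no online algorithm. *)

Set Implicit Arguments.
Unset Strict Implicit.
Unset Printing Implicit Defensive.
Import Order.TTheory.

Definition order_convex d (T : orderType d) (A : set T) : Prop :=
  forall x y z : T, A x -> A z -> (x <= y <= z)%O -> A y.

Definition prefix_proper (T : Type) (n K : nat) (I : 'I_n -> set T)
    (c : 'I_n -> 'I_K) (k : nat) : Prop :=
  forall t : nat, (t <= k)%N -> forall p : T,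
  (2 <= #|covering I t p|)%N -> ~ monochromatic c (covering I t p).

Definition sole_owner (T : Type) (n : nat) (I : 'I_n -> set T) (k : nat)
    (o : 'I_n) (q : T) : Prop :=
  covering I k q = [set o]%SET.

Lemma in_covering (T : Type) (n : nat) (I : 'I_n -> set T) t p i :
  i \in covering I t p <-> (i < t)%N /\ I i p.
Proof.
rewrite inE; split; first by move=> /andP[? /set_mem].
by move=> [-> /mem_set ->].
Qed.

Lemma in_sole_owner (T : Type) (n : nat) (I : 'I_n -> set T) k o q :
  sole_owner I k o q -> (o < k)%N /\ I o q.
Proof. by move=> oq; apply/in_covering; rewrite oq set11. Qed.

Lemma sole_ownerP (T : Type) (n : nat) (I : 'I_n -> set T) k o q (i : 'I_n) :
  sole_owner I k o q -> (i < k)%N -> I i q -> i = o.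
Proof. by move=> oq ik iq; apply/set1P; rewrite -oq; apply/in_covering. Qed.

Lemma covering_mono (T : Type) (n : nat) (I : 'I_n -> set T) t k p :
  (t <= k)%N -> covering I t p \subset covering I k p.
Proof.
move=> tk; apply/fintype.subsetP => i /in_covering[it ip]; apply/in_covering.
by split=> //; exact: leq_trans tk.
Qed.

Definition lies_left d (T : orderType d) (A : set T) (q : T) : Prop :=
  forall y, A y -> (y < q)%O.

Definition recolor_left d (T : orderType d) (n K : nat) (I : 'I_n -> set T)
    (q : T) (s : {perm 'I_K}) (c : 'I_n -> 'I_K) (i : 'I_n) : 'I_K :=
  if `[< lies_left (I i) q >] then s (c i) else c i.

(** A monochromatic set of intervals through a common point that was not
    monochromatic before must mix recolored and unchanged intervals.  Then the
    common point is left of [q], so an unchanged interval reaches [q] by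
    convexity and is the sole owner [o].  The common color is thus [c o], which
    [s] fixes, so the recolored intervals had that color from the start. *)
Lemma prefix_proper_recolor_left d (T : orderType d) (n K : nat)
    (I : 'I_n -> set T) (c : 'I_n -> 'I_K) (k : nat) (o : 'I_n) (q : T)
    (s : {perm 'I_K}) :
  (forall i, order_convex (I i)) ->
  sole_owner I k o q -> s (c o) = c o ->
  prefix_proper I c k -> prefix_proper I (recolor_left I q s c) k.
Proof.
move=> convI oq sco c_proper t tk p S2 [col S_col].
apply: (c_proper t tk p S2).
have [[i [iS iq]]|no_left] :=
    pselect (exists i, i \in covering I t p /\ lies_left (I i) q); last first.
  exists col => i iS; rewrite -(S_col i iS) /recolor_left.
  by case: asboolP => // iq; case: no_left; exists i.
have [it ip] := (in_covering I t p i).1 iS.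
have pq : (p < q)%O := iq p ip.
have only_o j : j \in covering I t p -> ~ lies_left (I j) q -> j = o.
  move=> /in_covering[jt jp] /existsNP[y /not_implyP[jy /negP]].
  rewrite -leNgt => qy; apply: (sole_ownerP oq); first exact: leq_trans tk.
  by apply: (convI j) jp jy _; rewrite (ltW pq).
have [[j [jS jq]]|all_left] :=
    pselect (exists j, j \in covering I t p /\ ~ lies_left (I j) q); last first.
  exists (s^-1%g col) => j jS; rewrite -(S_col j jS) /recolor_left.
  case: asboolP => [_|jq]; first by rewrite permK.
  by case: all_left; exists j.
have colE : col = c o.
  rewrite -(S_col j jS) /recolor_left asboolF //.
  by rewrite (only_o j jS jq).
exists (c o) => l lS; have := S_col l lS; rewrite /recolor_left colE.
by case: asboolP => // _; rewrite -{1}sco => /perm_inj.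
Qed.

Lemma prefix_proper_perm (T : Type) (n K : nat) (I : 'I_n -> set T)
    (c : 'I_n -> 'I_K) (k : nat) (s : {perm 'I_K}) :
  prefix_proper I c k -> prefix_proper I (s \o c) k.
Proof.
move=> c_proper t tk p S2 [col S_col]; apply: (c_proper t tk p S2).
by exists (s^-1%g col) => i iS; rewrite -(S_col i iS) /= permK.
Qed.

Lemma third_color (a b : 'I_3) : exists x : 'I_3, x != a /\ x != b.
Proof.
have : (0 < #|~: [set a; b]|)%N.
  rewrite -(ltn_add2l #|[set a; b]|) cardsC addn0 card_ord ltnS.
  by rewrite cards2; case: (_ != _).
by move=> /card_gt0P[x]; rewrite !inE negb_or => /andP[xa xb]; exists x.
Qed.

(** The points are added from right to left.  Recoloring strictly to the left
    of the next point [q] leaves alone the owners of [q] and of all points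
    beyond it, and reaches the owner of the new point [p] unless it is also the
    owner of [q]. *)
Lemma avoid_color_on_points d (T : orderType d) (n : nat) (I : 'I_n -> set T)
    (c : 'I_n -> 'I_3) (k : nat) (a : 'I_3) (ps : seq T) :
  (forall i, order_convex (I i)) -> prefix_proper I c k ->
  sorted <=%O ps -> (forall p, p \in ps -> exists o, sole_owner I k o p) ->
  exists2 c' : 'I_n -> 'I_3, prefix_proper I c' k &
    forall p o, p \in ps -> sole_owner I k o p -> c' o != a.
Proof.
move=> convI c_proper; elim: ps => [|p ps IH] p_ps owned; first by exists c.
have [|q qps|{c_proper} c1 c1_proper c1_avoid] := IH.
- exact: path_sorted p_ps.
- by apply: owned; rewrite inE qps orbT.
have [o op] := owned p (mem_head p ps).
have [c1o|c1o] := eqVneq (c1 o) a; last first.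
  exists c1 => // r o' /predU1P[-> o'p|]; last exact: c1_avoid.
  by rewrite (set1_inj (etrans (esym o'p) op)).
case: ps {IH} p_ps owned c1_avoid => [|q ps] p_ps owned c1_avoid.
  have [b [ba _]] := third_color a a.
  exists (tperm a b \o c1); first exact: prefix_proper_perm.
  move=> r o' /predU1P[->|//] o'p.
  by rewrite (set1_inj (etrans (esym o'p) op)) /= c1o tpermL.
have [u uq] : exists u, sole_owner I k u q.
  by apply: owned; rewrite !inE eqxx orbT.
have c1u : c1 u != a by apply: c1_avoid uq; rewrite mem_head.
have [b [ba bu]] := third_color a (c1 u).
have fix_u : tperm a b (c1 u) = c1 u by rewrite tpermD // eq_sym.
exists (recolor_left I q (tperm a b) c1).
  exact: prefix_proper_recolor_left uq fix_u c1_proper.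
have q_min r : r \in q :: ps -> (q <= r)%O.
  move=> /predU1P[->|] //; move: p_ps => /= /andP[_].
  by rewrite (path_sortedE le_trans) => /andP[/allP + _]; apply.
move=> r o' /predU1P[-> o'p|rps o'r].
  rewrite (set1_inj (etrans (esym o'p) op)) /recolor_left c1o.
  case: asboolP => [_|]; first by rewrite tpermL.
  (* Otherwise [o] contains [q] too, so it is [u], of a color other than [a]. *)
  have [ok Iop] := in_sole_owner op.
  move=> /existsNP[y /not_implyP[oy /negP]]; rewrite -leNgt => qy.
  move: c1u; rewrite -(sole_ownerP uq ok) ?c1o ?eqxx //.
  by apply: (convI o) Iop oy _; rewrite qy andbT; case/andP: p_ps.
rewrite /recolor_left asboolF; first exact: c1_avoid o'r.
move=> /(_ r (in_sole_owner o'r).2).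
by rewrite ltNge q_min.
Qed.

Lemma avoid_color_on_sole_owners d (T : orderType d) (n : nat)
    (I : 'I_n -> set T) (c : 'I_n -> 'I_3) (k : nat) (a : 'I_3) :
  (forall i, order_convex (I i)) -> prefix_proper I c k ->
  exists2 c' : 'I_n -> 'I_3, prefix_proper I c' k &
    forall p o, sole_owner I k o p -> c' o != a.
Proof.
move=> convI c_proper.
have /choice[f fP] : forall i, exists w : option T,
    if w is Some p then sole_owner I k i p else forall p, ~ sole_owner I k i p.
  move=> i; have [[p ip]|none] := pselect (exists p, sole_owner I k i p).
    by exists (Some p).
  by exists None => p ip; apply: none; exists p.
pose ps := sort <=%O (pmap f (enum 'I_n)).
have psP p : p \in ps -> exists o, sole_owner I k o p.
  rewrite mem_sort mem_pmap => /mapP[i _ fi].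
  by exists i; have := fP i; rewrite -fi.
have [c' c'_proper c'_avoid] :=
  avoid_color_on_points a convI c_proper (sort_sorted le_total _) psP.
exists c' => // p o op; case fo : (f o) (fP o) => [r|] or; last by case: (or p).
apply: c'_avoid or; rewrite mem_sort mem_pmap -fo.
by apply: map_f; rewrite mem_enum.
Qed.

Lemma prefix_proper_extend (T : Type) (n K : nat) (I : 'I_n -> set T)
    (c : 'I_n -> 'I_K) (m : 'I_n) (a : 'I_K) :
  prefix_proper I c m -> (forall p o, sole_owner I m o p -> c o != a) ->
  prefix_proper I (fun i => if i == m then a else c i) m.+1.
Proof.
move=> c_proper c_avoid.
have old i t p : (t <= m)%N -> i \in covering I t p -> i != m.
  move=> tm /in_covering[it _]; apply: contraTneq it => ->.
  by rewrite -leqNgt.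
have low t p : (t <= m)%N -> (2 <= #|covering I t p|)%N ->
    ~ monochromatic (fun i => if i == m then a else c i) (covering I t p).
  move=> tm S2 [col S_col]; apply: (c_proper t tm p S2).
  by exists col => i iS; rewrite -(S_col i iS) (negPf (old i t p tm iS)).
move=> t; rewrite leq_eqVlt ltnS => /predU1P[->|tm] p; last exact: low.
move=> S2 [col S_col].
have [S2'|] := leqP 2 #|covering I m p|.
  apply: (low m p (leqnn m) S2'); exists col => i iS; apply: S_col.
  exact: fintype.subsetP (covering_mono I p (leqnSn m)) i iS.
have sub : covering I m.+1 p \subset m |: covering I m p.
  apply/fintype.subsetP => i /in_covering[im ip]; apply/setU1P.
  move: im; rewrite ltnS leq_eqVlt => /predU1P[/val_inj->|im]; first by left.
  by right; apply/in_covering.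
have m_old : m \notin covering I m p.
  by apply/negP => /(old _ _ _ (leqnn m)); rewrite eqxx.
rewrite ltnS => S1.
have := leq_trans S2 (subset_leq_card sub).
rewrite cardsU1 m_old ltnS => S1'.
have /cards1P[o So] : #|covering I m p| == 1%N by rewrite eqn_leq S1.
have om : o \in covering I m p by rewrite So set11.
have mS : m \in covering I m.+1 p.
  have /eqP-> // : covering I m.+1 p == m |: covering I m p.
    by rewrite eqEcard sub cardsU1 m_old So cards1.
  by rewrite setU11.
have /eqP[] := c_avoid p o So.
have := S_col o (fintype.subsetP (covering_mono I p (leqnSn m)) o om).
by rewrite (negPf (old o m p (leqnn m) om)) -(S_col m mS) eqxx.
Qed.

Lemma prefix_proper_exists d (T : orderType d) (n : nat) (I : 'I_n -> set T)
    (k : nat) :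
  (forall i, order_convex (I i)) -> (k <= n)%N ->
  exists c : 'I_n -> 'I_3, prefix_proper I c k.
Proof.
move=> convI; elim: k => [_|k IH kn].
  exists (fun=> ord0) => t; rewrite leqn0 => /eqP-> p.
  by rewrite (_ : covering I 0 p = finset.set0) ?cards0 //; apply/setP => i;
     rewrite !inE.
have [c c_proper] := IH (ltnW kn).
have [c' c'_proper c'_avoid] :=
  avoid_color_on_sole_owners ord_max convI c_proper.
eexists; exact: (@prefix_proper_extend _ _ _ I c' (Ordinal kn) ord_max).
Qed.

Lemma open_interval_convex (R : realType) (A : set R) :
  open_interval A -> order_convex A.
Proof.
move=> [x0 [x1 ->]] x y z /= /andP[x0x _] /andP[_ zx1] /andP[xy yz].
by rewrite (lt_le_trans x0x xy) (le_lt_trans yz zx1).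
Qed.

Theorem theorem14 (R : realType) (n : nat) (I : 'I_n -> set R)
    (hI : forall i : 'I_n, open_interval (I i)) :
  exists c : 'I_n -> 'I_3, quasi_online_proper 2 I c.
Proof.
have convI i : order_convex (I i) by exact: open_interval_convex.
have [c c_proper] := prefix_proper_exists convI (leqnn n).
by exists c => t /andP[_ tn]; apply: c_proper.
Qed.
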